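(* Let $A=(a_{ij})\in\mathbb{R}^{n\times n}$ (the crisp coefficient matrix of a fuzzy system of linear equations $Ax=b$), and let $S\in\mathbb{R}^{2n\times 2n}$ be the associated matrix $S=\begin{pmatrix} S_1 & S_2\\ S_2 & S_1\end{pmatrix}$, where $S_1=(\alpha_{ij})\in\mathbb{R}^{n\times n}$ has entries $\alpha_{ij}=a_{ij}$ if $a_{ij}>0$ and $\alpha_{ij}=0$ otherwise, and $S_2=A-S_1$. If $A$ is an H-matrix, or an M-matrix, or strictly diagonally dominant, then $S$ is nonsingular, and the system $SX=Y$ has the unique solution $X^*=S^{-1}Y$.
   Context: A square real matrix $B=(b_{ij})\in\mathbb{R}^{k\times k}$ is an M-matrix if $b_{ii}>0$ for all $i$, $b_{ij}\le 0$ for all $i\neq j$, $B$ is nonsingular, and $B^{-1}\ge 0$ entrywise. The comparison matrix $\mathcal{M}(B)=(m_{ij})$ is defined by $m_{ii}=|b_{ii}|$ and $m_{ij}=-|b_{ij}|$ for $i\ne j$. The matrix $B$ is an H-matrix if $\mathcal{M}(B)$ is an M-matrix. $B$ is strictly diagonally dominant if $|b_{ii}|>\sum_{j\neq i}|b_{ij}|$ for every $i$. The system $SX=Y$ is the crisp $2n\times 2n$ linear system associated with the fuzzy system $Ax=b$: a fuzzy number in parametric form is a pair of functions $(\underline{u}(r),\overline{u}(r))$, $0\le r\le 1$, with $\underline{u}$ bounded, left continuous and nondecreasing, $\overline{u}$ bounded, right continuous and nonincreasing, and $\underline{u}(r)\le\overline{u}(r)$ for all $r\in[0,1]$. If the right-hand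 side $b$ is the vector of fuzzy numbers $(\underline{y}_i(r),\overline{y}_i(r))$, $i=1,\ldots,n$, then $Y=(\underline{y}_1,\ldots,\underline{y}_n,\overline{y}_1,\ldots,\overline{y}_n)^T$, the unknown is $X=(\underline{x}_1,\ldots,\underline{x}_n,\overline{x}_1,\ldots,\overline{x}_n)^T$, and $SX=Y$ is understood for each $r\in[0,1]$. Here $X$ is only a vector of real-valued functions of $r$; its components are not asserted to form fuzzy numbers. *)

(* Defs.v *)
From HB Require Import structures.
From mathcomp Require Import all_boot all_order all_algebra.
From mathcomp Require Import all_classical all_reals all_analysis.

Set Implicit Arguments.
Unset Strict Implicit.
Unset Printing Implicit Defensive.

Import Order.TTheory GRing.Theory Num.Theory.
Import numFieldNormedType.Exports.

Local Open Scope classical_set_scope.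
Local Open Scope ring_scope.

Definition is_Mmatrix (R : realFieldType) (k : nat) (B : 'M[R]_k) : Prop :=
  [/\ forall i, 0 < B i i,
      forall i j, i != j -> B i j <= 0,
      B \in unitmx
    & forall i j, 0 <= invmx B i j].

Definition comparison_mx (R : realFieldType) (k : nat) (B : 'M[R]_k) : 'M[R]_k :=
  \matrix_(i, j) if i == j then `|B i j| else - `|B i j|.

Definition is_Hmatrix (R : realFieldType) (k : nat) (B : 'M[R]_k) : Prop :=
  is_Mmatrix (comparison_mx B).

Definition strictly_diag_dominant (R : realFieldType) (k : nat)
    (B : 'M[R]_k) : Prop :=
  forall i, \sum_(j | j != i) `|B i j| < `|B i i|.

Definition S1_mx (R : realFieldType) (n : nat) (A : 'M[R]_n) : 'M[R]_n :=
  \matrix_(i, j) if 0 < A i j then A i j else 0.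

Definition S2_mx (R : realFieldType) (n : nat) (A : 'M[R]_n) : 'M[R]_n :=
  A - S1_mx A.

Definition S_mx (R : realFieldType) (n : nat) (A : 'M[R]_n) : 'M[R]_(n + n) :=
  block_mx (S1_mx A) (S2_mx A) (S2_mx A) (S1_mx A).

(* The branches are total functions on R, but only their restrictions to      *)
(* [0, 1] matter.  Since their domain is [0, 1], left continuity says nothing *)
(* at 0 and right continuity says nothing at 1.                               *)
Record fuzzy_number (R : realType) := FuzzyNumber {
  lower : R -> R;
  upper : R -> R;
  lower_bounded : exists M : R, {in `[0, 1], forall r, `|lower r| <= M};
  lower_left_continuous : {in `]0, 1], forall r, lower x @[x --> r^'-] --> lower r};
  lower_nondecreasing : {in `[0, 1] &, {homo lower : r s / r <= s}};
  upper_bounded : exists M : R, {in `[0, 1], forall r, `|upper r| <= M};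
  upper_right_continuous : {in `[0, 1[, forall r, upper x @[x --> r^'+] --> upper r};
  upper_nonincreasing : {in `[0, 1] &, {homo upper : r s / r <= s >-> s <= r}};
  lower_le_upper : {in `[0, 1], forall r, lower r <= upper r}
}.

Definition rhs_Y (R : realType) (n : nat) (b : 'I_n -> fuzzy_number R) (r : R) :
    'cV[R]_(n + n) :=
  col_mx (\col_i lower (b i) r) (\col_i upper (b i) r).

(* A vector of m real functions of r is represented as a map R -> 'cV[R]_m,   *)
(* again considered on [0, 1] only.                                           *)
Definition is_solution (R : realType) (m : nat) (S : 'M[R]_m)
    (Y X : R -> 'cV[R]_m) : Prop :=
  {in `[0, 1], forall r, S *m X r = Y r}.

(* Main.v *)
Require Import Defs.
From mathcomp Require Import all_boot all_order all_algebra.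
From mathcomp Require Import all_classical all_reals all_analysis.

Set Implicit Arguments.
Unset Strict Implicit.
Unset Printing Implicit Defensive.

Import Order.TTheory GRing.Theory Num.Theory.

Local Open Scope ring_scope.

(** Each of the three hypotheses on [A] provides a positive vector [w] for
    which [A] is strictly diagonally dominant after its columns are scaled by
    [w]: the constant vector if [A] is strictly diagonally dominant, and the
    solution of [comparison_mx A *m w = 1] if [A] is an H-matrix
    ([Hmatrix_weighted_dominant]); an M-matrix is its own comparison matrix,
    hence an H-matrix.  A weighted dominant matrix is nonsingular
    ([weighted_dominant_unitmx]).

    The matrix [S] need not be weighted dominant, since a negative diagonal
    entry of [A] leaves a zero on the diagonal of [S].  However, the change of
    variables [(x, y) |-> (x + y, x - y)] splits the homogeneous system
    [S (x, y) = 0] into [(S1 + S2) (x + y) = 0] and [(S1 - S2) (x - y) = 0].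
    Here [S1 + S2] is [A], while [S1 - S2] is the entrywise absolute value of
    [A].  Weighted dominance depends only on absolute values of entries, so
    both matrices are nonsingular, and therefore so is [S]. *)

(** * Nonsingularity from weighted diagonal dominance *)

Lemma col_ker0_unitmx (F : fieldType) (n : nat) (B : 'M[F]_n) :
  (forall v : 'cV[F]_n, B *m v = 0 -> v = 0) -> B \in unitmx.
Proof.
move=> ker0; rewrite -unitmx_tr unitmxE unitfE; apply/det0P => -[v v_neq0 vB0].
case/negP: v_neq0; apply/eqP/trmx_inj; rewrite trmx0; apply: ker0.
by rewrite -[B]trmxK -trmx_mul vB0 trmx0.
Qed.

Definition weighted_dominant (R : realFieldType) (n : nat) (w : 'I_n -> R)
    (B : 'M[R]_n) : Prop :=
  (forall i, 0 < w i) /\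
  forall i, \sum_(j | j != i) `|B i j| * w j < `|B i i| * w i.

(** If [B *m v = 0] with [v != 0], the row whose index [i] maximizes the ratio
    [`|v i| / w i] contradicts dominance: the diagonal term of that row is
    larger than the sum of all the others. *)
Lemma weighted_dominant_unitmx (R : realFieldType) (n : nat) (w : 'I_n -> R)
    (B : 'M[R]_n) :
  weighted_dominant w B -> B \in unitmx.
Proof.
move=> [w_gt0 domB]; apply: col_ker0_unitmx => v Bv0.
apply/colP => i0; rewrite mxE; apply/eqP/negPn/negP => vi0_neq0.
case: (@Order.TotalTheory.arg_maxP _ _ _ i0 predT
         (fun j => `|v j 0| / w j) isT) => i _ imax.
set t := `|v i 0| / w i in imax.
have t_gt0 : 0 < t.
  by apply: lt_le_trans (imax i0 isT); rewrite divr_gt0 ?normr_gt0.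
have v_le j : `|v j 0| <= t * w j by rewrite -ler_pdivrMr //; exact: imax.
have vi_eq : `|v i 0| = t * w i by rewrite /t divfK // gt_eqF.
have /matrixP/(_ i 0) := Bv0; rewrite !mxE (bigD1 i) //= => /eqP.
rewrite addr_eq0 => /eqP /(congr1 Num.norm); rewrite normrN normrM vi_eq => diag.
suff : `|B i i| * (t * w i) < `|B i i| * (t * w i) by rewrite ltxx.
rewrite {1}diag; apply: (@le_lt_trans _ _ (t * \sum_(j | j != i) `|B i j| * w j)).
  apply: le_trans (ler_norm_sum _ _ _) _; rewrite mulr_sumr.
  by apply: ler_sum => j _; rewrite normrM mulrCA ler_wpM2l.
by rewrite mulrCA ltr_pM2l.
Qed.

Lemma weighted_dominant_eq_norm (R : realFieldType) (n : nat) (w : 'I_n -> R)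
    (B C : 'M[R]_n) :
  (forall i j, `|C i j| = `|B i j|) ->
  weighted_dominant w B -> weighted_dominant w C.
Proof.
move=> normC [w_gt0 domB]; split=> // i; rewrite normC.
by under eq_bigr do rewrite normC.
Qed.

(** * The three classes of coefficient matrices *)

(** The vector [w := (comparison_mx A)^-1 1] is nonnegative because the inverse
    is.  Row [i] of [comparison_mx A *m w = 1] reads
    [`|A i i| w_i - \sum_(j != i) `|A i j| w_j = 1], which gives both the
    dominance and, the sum being nonnegative, the positivity of [w i]. *)
Lemma Hmatrix_weighted_dominant (R : realFieldType) (n : nat) (A : 'M[R]_n) :
  is_Hmatrix A -> exists w, weighted_dominant w A.
Proof.
case=> _ _ unitM inv_ge0.
pose u := invmx (comparison_mx A) *m const_mx 1 : 'cV[R]_n.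
have u_ge0 i : 0 <= u i 0.
  by rewrite mxE sumr_ge0 // => j _; rewrite mxE mulr1.
have row_eq i : `|A i i| * u i 0 = 1 + \sum_(j | j != i) `|A i j| * u j 0.
  have /matrixP/(_ i 0) : comparison_mx A *m u = const_mx 1 by rewrite mulKVmx.
  rewrite mxE (bigD1 i) //= [const_mx _ _ _]mxE [comparison_mx A i i]mxE eqxx.
  move=> <-; rewrite -addrA -big_split /=.
  rewrite big1 ?addr0 // => j ji.
  by rewrite mxE eq_sym (negbTE ji) mulNr addNr.
exists (fun i => u i 0); split=> i; last by rewrite row_eq ltrDr ltr01.
rewrite lt_neqAle u_ge0 andbT eq_sym; apply/eqP => ui0.
have := row_eq i; rewrite ui0 mulr0 => /eqP; rewrite eq_sym gt_eqF //.
by rewrite ltr_pwDl // sumr_ge0 // => j _; rewrite mulr_ge0.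
Qed.

Lemma Mmatrix_Hmatrix (R : realFieldType) (n : nat) (A : 'M[R]_n) :
  is_Mmatrix A -> is_Hmatrix A.
Proof.
move=> MA; rewrite /is_Hmatrix; suff -> : comparison_mx A = A by [].
case: MA => diag_gt0 off_le0 _ _; apply/matrixP => i j; rewrite mxE.
have [<-|ij] := eqVneq i j; first by rewrite gtr0_norm.
by rewrite ler0_norm ?opprK // off_le0.
Qed.

Lemma strictly_diag_dominant_weighted (R : realFieldType) (n : nat)
    (A : 'M[R]_n) :
  strictly_diag_dominant A -> weighted_dominant (fun=> 1) A.
Proof.
move=> domA; split=> // i; rewrite mulr1.
by under eq_bigr do rewrite mulr1; exact: domA.
Qed.

(** * The associated matrix of double size *)

Lemma symmetric_block_unitmx (F : numFieldType) (n : nat) (P Q : 'M[F]_n) :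
  P + Q \in unitmx -> P - Q \in unitmx -> block_mx P Q Q P \in unitmx.
Proof.
move=> unitD unitB; apply: col_ker0_unitmx => v.
rewrite -[v]vsubmxK; set x := usubmx v; set y := dsubmx v.
rewrite mul_block_col -[in RHS]col_mx0 => /eq_col_mx [eq1 eq2].
have sum0 : x + y = 0.
  apply: (can_inj (mulKmx unitD)); rewrite mulmx0 mulmxDl !mulmxDr.
  by rewrite [Q *m x + _]addrC addrACA eq1 [P *m y + _]addrC eq2 addr0.
have diff0 : x - y = 0.
  apply: (can_inj (mulKmx unitB)); rewrite mulmx0 mulmxBl !mulmxBr.
  by rewrite opprB addrACA eq1 -opprD [P *m y + _]addrC eq2 subr0.
have xy : x = y by apply/eqP; rewrite -subr_eq0 diff0.
have y0 : y = 0.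
  apply/eqP; move/eqP: sum0.
  by rewrite xy -mulr2n -scaler_nat scaler_eq0 pnatr_eq0.
by rewrite xy y0 col_mx0.
Qed.

Lemma S1_sub_S2E (R : realFieldType) (n : nat) (A : 'M[R]_n) :
  S1_mx A - S2_mx A = map_mx Num.norm A.
Proof.
apply/matrixP => i j; rewrite !mxE; case: ltrP => [gt0|le0].
  by rewrite subrr subr0 gtr0_norm.
by rewrite subr0 sub0r ler0_norm.
Qed.

Lemma S_mx_unitmx (R : realFieldType) (n : nat) (w : 'I_n -> R) (A : 'M[R]_n) :
  weighted_dominant w A -> S_mx A \in unitmx.
Proof.
move=> domA; apply: symmetric_block_unitmx.
  by rewrite /S2_mx addrC subrK; exact: weighted_dominant_unitmx domA.
rewrite S1_sub_S2E; apply: (@weighted_dominant_unitmx _ _ w).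
by apply: weighted_dominant_eq_norm domA => i j; rewrite mxE normr_id.
Qed.

Theorem mainTheorem4 (R : realType) (n : nat) (A : 'M[R]_n)
    (hA : [\/ is_Hmatrix A, is_Mmatrix A | strictly_diag_dominant A]) :
  S_mx A \in unitmx /\
  forall b : 'I_n -> fuzzy_number R,
    let Xstar := fun r : R => invmx (S_mx A) *m rhs_Y b r in
    is_solution (S_mx A) (rhs_Y b) Xstar /\
    forall X : R -> 'cV[R]_(n + n),
      is_solution (S_mx A) (rhs_Y b) X -> {in `[0, 1], X =1 Xstar}.
Proof.
have [w domA] : exists w, weighted_dominant w A.
  case: hA => [|/Mmatrix_Hmatrix|/strictly_diag_dominant_weighted].
  - exact: Hmatrix_weighted_dominant.
  - exact: Hmatrix_weighted_dominant.
  - by exists (fun=> 1).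
have unitS : S_mx A \in unitmx by exact: S_mx_unitmx domA.
split=> // b Xstar; split=> [r _|X solX r r01]; first by rewrite /Xstar mulKVmx.
by rewrite /Xstar -(solX r r01) mulKmx.
Qed.
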